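(* Let $\mathfrak M$ be the set of all functions $E:\mathbb Z^{\ge0}\to[0,\infty)$ such that $\mathbb E_{X\sim P}[E(X)]\le1$ for all $P\in\mathcal M$, and let $$\mathfrak R=\{\rho:\mathbb Z^{\ge0}\to[0,\infty)\ :\ 0=\rho(0)\le\rho(1)\le\rho(2)\le\cdots,\ \ \rho(n)\le n\text{ for all }n\}.$$ Then $$\mathfrak M=\{\,n\mapsto\rho(n+1)-\rho(n)\ :\ \rho\in\mathfrak R\,\}.$$ That is, the functions of the form $n\mapsto \rho(n+1)-\rho(n)$ with $\rho\in\mathfrak R$ are exactly all e-values testing monotonicity.
   Context: $\mathbb Z^{\ge0}=\{0,1,2,\dots\}$; for a probability measure $P$ on $\mathbb Z^{\ge0}$, $f_P(n)=P(\{n\})$. $\mathcal M$ is the set of probability measures $P$ on $\mathbb Z^{\ge0}$ with $f_P(n)\ge f_P(n+1)$ for all $n\in\mathbb Z^{\ge0}$. An e-value for a class of distributions is a nonnegative function of the observation with expectation at most 1 under every member of the class. *)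

(* Defs.v *)
From HB Require Import structures.
From mathcomp Require Import all_boot all_order all_algebra.
From mathcomp Require Import all_classical all_reals all_analysis.

Set Implicit Arguments.
Unset Strict Implicit.
Unset Printing Implicit Defensive.

Import Order.TTheory GRing.Theory Num.Theory.

Local Open Scope classical_set_scope.
Local Open Scope ring_scope.

(* The canonical sigma-algebra on nat contains every subset, so a probability
   on nat is a measure on all subsets and every function on nat is measurable. *)
Definition monotone_probability (R : realType) : set (probability nat R) :=
  [set P : probability nat R | forall n : nat, (P [set n.+1] <= P [set n])%E].

(* The expectation is the [\bar R]-valued integral of a nonnegative function
   (possibly +oo), so the bound by 1 carries its own integrability. *)
Definition evalues (R : realType) (C : set (probability nat R)) :
    set (nat -> R) :=
  [set E : nat -> R | (forall n : nat, 0 <= E n) /\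
           (forall P : probability nat R, C P -> ('E_P[E] <= 1)%E)].

Definition growth_functions (R : realType) : set (nat -> R) :=
  [set rho : nat -> R | [/\ forall n : nat, 0 <= rho n,
                 rho 0%N = 0,
                 nondecreasing_seq rho &
                 forall n : nat, rho n <= n%:R]].

Definition increments (R : realType) (rho : nat -> R) : nat -> R :=
  fun n => rho n.+1 - rho n.

(* Main.v *)
(* Testing an e-value against the uniform law on {0, ..., n} gives the bound
   rho(n+1) <= n+1 for its partial sums rho. Conversely, a monotone law is a
   mixture of these uniform laws, which Abel summation of
   sum_k (rho(k+1) - rho(k)) P{k} exploits without naming the mixture. *)
Require Import Defs.
From HB Require Import structures.
From mathcomp Require Import all_boot all_order all_algebra.
From mathcomp Require Import all_classical all_reals all_analysis.
From mathcomp Require Import lra.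

Set Implicit Arguments.
Unset Strict Implicit.
Unset Printing Implicit Defensive.

Import Order.TTheory GRing.Theory Num.Theory.

Local Open Scope classical_set_scope.
Local Open Scope ring_scope.

(** Built from Dirac masses at 0, ..., n so that the measure structure is inherited and integrals
    reduce to finite sums; the scaling by [n.+1%:R^-1] makes the total mass 1. *)
Definition uniform_initial (R : realType) (n : nat) : set nat -> \bar R :=
  mscale (n.+1%:R^-1)%:nng (msum (fun k => \d_k) n.+1).

HB.instance Definition _ (R : realType) (n : nat) :=
  Measure.on (@uniform_initial R n).

Lemma uniform_initial_setT (R : realType) (n : nat) :
  @uniform_initial R n setT = 1%E.
Proof.
rewrite /uniform_initial /mscale /= /msum.
under eq_bigr do rewrite /= diracT.
by rewrite sumEFin -EFinM sumr_const card_ord mulVf.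
Qed.

HB.instance Definition _ (R : realType) (n : nat) :=
  Measure_isProbability.Build _ _ _ (@uniform_initial R n)
    (@uniform_initial_setT R n).

Lemma uniform_initial_set1 (R : realType) (n k : nat) :
  @uniform_initial R n [set k] = ((k <= n)%N%:R / n.+1%:R)%:E.
Proof.
rewrite /uniform_initial /mscale /= /msum mulrC EFinM; congr (_ * _)%E.
under eq_bigr do rewrite /= diracE in_set1.
rewrite sumEFin; congr (_%:E).
have [kn|nk] := leqP k n.
  (* For [k <= n], only the Dirac mass at [k] itself contributes. *)
  rewrite (bigD1 (Ordinal (kn : (k < n.+1)%N))) //= eqxx big1 ?addr0 // => i ik.
  by rewrite -val_eqE /= in ik; rewrite (negbTE ik).
rewrite big1 // => i _; case: eqP => // ik.
by have := ltn_ord i; rewrite ik ltnS leqNgt nk.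
Qed.

Lemma uniform_initial_monotone (R : realType) (n : nat) :
  monotone_probability (@uniform_initial R n).
Proof.
move=> k /=; rewrite !uniform_initial_set1 lee_fin ler_pM2r ?invr_gt0 //.
by rewrite ler_nat; case: (ltnP k n) => // /ltnW ->.
Qed.

Lemma expectation_uniform_initial (R : realType) (n : nat) (E : nat -> R) :
  (forall k, 0 <= E k) ->
  ('E_(@uniform_initial R n)[E])%E = (n.+1%:R^-1 * \sum_(k < n.+1) E k)%:E.
Proof.
move=> E0; rewrite unlock ge0_integral_mscale //; last first.
  by move=> k _; rewrite lee_fin.
rewrite ge0_integral_measure_sum //; last by move=> k _; rewrite lee_fin.
under eq_bigr do rewrite integral_dirac //= diracT mul1e.
by rewrite sumEFin.
Qed.

(** Cutting the integral along singletons, on each of which [E] is constant, gives a series whose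
    partial sums are open to Abel summation. *)
Lemma expectation_nat (R : realType) (P : probability nat R) (E : nat -> R) :
  (forall k, 0 <= E k) ->
  ('E_P[E])%E = (\sum_(0 <= k <oo) ((E k)%:E * P [set k]))%E.
Proof.
move=> E0; rewrite unlock.
have <- : \bigcup_k [set k] = [set: nat] by rewrite -subTset => k _; exists k.
rewrite ge0_integral_bigcup //.
- apply: eq_eseriesr => k _; rewrite -integral_cst //.
  by apply: eq_integral => x; rewrite inE => ->.
- by move=> k _; rewrite lee_fin.
- by move=> i j _ _ [x [/= <- <-]].
Qed.

(* Abel summation: the left-hand side grows by at most [p n] at each step,
   because [n.+1%:R - rho n.+1 >= 0] and [p n.+1 <= p n]. *)
Lemma increments_sum_le (R : realType) (rho p : nat -> R) (n : nat) :
  rho 0%N = 0 -> (forall n, rho n <= n%:R) -> (forall n, p n.+1 <= p n) ->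
  \sum_(0 <= k < n) increments rho k * p k + (n%:R - rho n) * p n
    <= \sum_(0 <= k < n) p k.
Proof.
move=> rho0 rho_le p_le; elim: n => [|n IHn].
  by rewrite !big_geq // rho0 subrr mul0r addr0.
rewrite !big_nat_recr //=; apply: le_trans (lerD IHn (lexx (p n))).
have : (n.+1%:R - rho n.+1) * p n.+1 <= (n.+1%:R - rho n.+1) * p n.
  by rewrite ler_wpM2l // subr_ge0.
by rewrite /increments -natr1; nra.
Qed.

(** Every partial sum of the expectation is at most the mass of an initial segment, since the
    boundary term [(n%:R - rho n) * p n] left by Abel summation is nonnegative; the bound then
    passes to the limit. *)
Lemma monotone_expectation_increments_le1 (R : realType)
    (P : probability nat R) (rho : nat -> R) :
  monotone_probability P -> growth_functions rho ->
  ('E_P[increments rho] <= 1)%E.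
Proof.
move=> Pmon [_ rho0 rho_nd rho_le].
have inc0 k : 0 <= increments rho k by rewrite subr_ge0 rho_nd.
have Pfin k : P [set k] \is a fin_num by exact: fin_num_measure.
rewrite expectation_nat //; apply: lime_le.
  by apply: is_cvg_nneseries => k _ _; rewrite mule_ge0 // lee_fin.
(* The masses are finite, so the partial sums can be compared in [R]. *)
apply: nearW => n; pose p k := fine (P [set k]).
under eq_bigr do rewrite -(fineK (Pfin _)) -EFinM.
rewrite sumEFin.
have p0 k : 0 <= p k by rewrite fine_ge0.
have p_le k : p k.+1 <= p k by rewrite fine_le.
have := increments_sum_le n rho0 rho_le p_le.
have : 0 <= (n%:R - rho n) * p n by rewrite mulr_ge0 // subr_ge0.
have p_sum : \sum_(0 <= k < n) p k <= 1.
  (* Disjoint singletons: the masses add up to the probability of their union. *)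
  rewrite -lee_fin -sumEFin big_mkord.
  under eq_bigr do rewrite fineK //.
  rewrite -measure_semi_additive_ord //.
  - exact: probability_le1.
  - by move=> i j _ _ [x [/= -> /ord_inj]].
by rewrite lee_fin => *; lra.
Qed.

Theorem theorem3p2 (R : realType) :
  evalues (@monotone_probability R) =
  [set increments rho | rho in @growth_functions R].
Proof.
apply/seteqP; split => [E [E0 E1]|_ [rho rhoG <-]]; last first.
  split=> [n|P Pmon]; last exact: monotone_expectation_increments_le1.
  by case: rhoG => _ _ rho_nd _; rewrite subr_ge0 rho_nd.
(* The value 0 at 0 and the increments [E] force [rho] to be the partial sums of [E]. *)
exists (fun n => \sum_(k < n) E k); last first.
  by apply/funext => n; rewrite /increments big_ord_recr /= addrAC subrr add0r.
split=> [n||m n mn|[|n]].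
- exact: sumr_ge0.
- by rewrite big_ord0.
- by rewrite -!(big_mkord xpredT) (big_cat_nat (leq0n m) mn) //= lerDl sumr_ge0.
- by rewrite big_ord0.
(* Under the uniform law on 0, ..., [n], the expectation of [E] is the candidate's value at [n.+1]
   divided by [n.+1]. *)
- have := E1 _ (@uniform_initial_monotone R n).
  by rewrite expectation_uniform_initial // lee_fin ler_pdivrMl // mulr1.
Qed.
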